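(* Let $n\ge2$ and let $T:Cvx_+(\mathbb{R}^n)\to Cvx_+(\mathbb{R}^n)$ be a bijection such that both $T$ and $T^{-1}$ are almost order preserving. Then there exist $B\in GL(n)$, $b_0\in\mathbb{R}^n$ and positive constants $c,C$ such that for all $f\in Cvx_+(\mathbb{R}^n)$ and all $x\in\mathbb{R}^n$, $$c\,f(Bx+b_0)\le (Tf)(x)\le C\,f(Bx+b_0).$$
   Context: $Cvx_+(\mathbb{R}^n)$ is the class of lower semicontinuous convex functions $f:\mathbb{R}^n\to[0,+\infty]$. Inequalities between functions are pointwise. A bijection $T$ of $Cvx_+(\mathbb{R}^n)$ is almost order preserving if there is a constant $\tilde C>1$ such that, with $\tilde c=\tilde C^{-1}$, for all $f,g$ in the class: (i) $f\le g$ implies $Tf\le\tilde C\,Tg$; (ii) $f\le\tilde c\,g$ implies $Tf\le Tg$. *)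

(* Defs.v *)
From HB Require Import structures.
From mathcomp Require Import all_boot all_order all_algebra.
From mathcomp Require Import all_classical all_reals all_analysis.

Set Implicit Arguments.
Unset Strict Implicit.
Unset Printing Implicit Defensive.

Import Order.TTheory GRing.Theory Num.Theory.
Import numFieldNormedType.Exports.

Local Open Scope classical_set_scope.
Local Open Scope ring_scope.
Local Open Scope ereal_scope.

(* The library's [convex_function] only covers real-valued functions. In \bar R
   0 * +oo = 0, so at t = 0 and t = 1 the inequality holds trivially, even
   where f is infinite. *)
Definition econvex (R : realType) (V : lmodType R) (f : V -> \bar R) :=
  forall (x y : V) (t : R), (0 <= t <= 1)%R ->
    f (t *: x + (1 - t) *: y)%R <= t%:E * f x + (1 - t)%:E * f y.

Definition Cvxp (R : realType) (n : nat) : set ('cV[R]_n -> \bar R) :=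
  [set f : 'cV[R]_n -> \bar R |
    [/\ forall x, 0 <= f x, econvex f & lower_semicontinuous f]].
Arguments Cvxp : clear implicits.

Definition almost_order_preserving (R : realType) (n : nat)
    (T : Cvxp R n -> Cvxp R n) :=
  exists2 C : R, (1 < C)%R & forall f g : Cvxp R n,
    ((forall x, \val f x <= \val g x) ->
       forall x, \val (T f) x <= C%:E * \val (T g) x) /\
    ((forall x, \val f x <= (C^-1)%R%:E * \val g x) ->
       forall x, \val (T f) x <= \val (T g) x).

(* Main.v *)
Require Import Defs.
From mathcomp Require Import all_boot all_order all_algebra.
From mathcomp Require Import all_classical all_reals all_analysis.
From mathcomp Require Import ring lra.

(* Call "spike" a function equal to a finite constant at one point and to +oo
   elsewhere. The functions above a spike form a chain, so T permutes the
   spikes: the spike of height c at x goes to that of height alpha_x(c) at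
   phi(x). Testing T on the indicators of segments shows that phi and its
   inverse map segments into segments, hence, as n >= 2, that phi is affine.
   Since f lies below the spike of height f(x) at x,
   (Tf)(phi x) <= C alpha_x(f x). A cone is proportional to s at distance s
   from its apex, and its image is convex; applied to T and to its inverse this
   gives alpha_z(s a) <= C' s alpha_x(a) and s alpha_x(a) <= C' alpha_z(s a)
   for z != x and 0 < s < 1 (up to constant factors on the heights), so
   alpha is bounded by a linear function uniformly in the point. This gives
   (Tf)(phi x) <= k (f x); the other inequality is the same for the inverse. *)

Set Implicit Arguments.
Unset Strict Implicit.
Unset Printing Implicit Defensive.

Import Order.TTheory GRing.Theory Num.Theory.
Import numFieldNormedType.Exports.

Local Open Scope classical_set_scope.
Local Open Scope ring_scope.

(** * Segment-preserving bijections *)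

Definition maps_segments (R : numDomainType) (V W : lmodType R) (f : V -> W) :=
  forall a b t, 0 <= t <= 1 ->
    exists2 s, 0 <= s <= 1 &
      f (t *: a + (1 - t) *: b) = s *: f a + (1 - s) *: f b.

Section SegmentPreserving.
Variables (R : archiRealFieldType).
Implicit Types V W : lmodType R.

(** For [t > 1], with [u] the combination, [a] lies on the segment from [u] to [b], so the
    expression of [f a] through [f u] and [f b] can be solved for [f u]; a zero coefficient of [f u]
    forces [a = b]. The case [t < 0] follows by swapping [a] and [b]. *)
Lemma maps_segments_lines V W (f : V -> W) : injective f -> maps_segments f ->
  forall a b t, exists s, f (t *: a + (1 - t) *: b) = s *: f a + (1 - s) *: f b.
Proof.
move=> finj fseg.
have large a b t : 1 < t ->
    exists s, f (t *: a + (1 - t) *: b) = s *: f a + (1 - s) *: f b.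
  move=> t1; set u := t *: a + _.
  have t0 : t != 0 by rewrite gt_eqF// (lt_trans _ t1).
  have ub : a = t^-1 *: u + (1 - t^-1) *: b.
    rewrite /u scalerDr !scalerA mulVf// scale1r -addrA -scalerDl.
    by rewrite mulrBr mulVf// mulr1 addrC subrKA subrr scale0r add0r.
  have [|s s01 fa] := fseg u b t^-1.
    by rewrite invr_ge0 ltW ?(lt_trans _ t1)//= invf_le1 ?ltW// (lt_trans _ t1).
  rewrite -ub in fa.
  have [s0|s0] := eqVneq s 0.
    move: fa; rewrite s0 scale0r add0r subr0 scale1r => /finj ab.
    exists 1; rewrite /u ab -scalerDl subrr scale0r addr0 scale1r.
    by rewrite subrKC scale1r.
  exists s^-1; rewrite fa scalerDr !scalerA mulVf// scale1r -addrA -scalerDl.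
  by rewrite mulrBr mulVf// mulr1 addrC subrKA subrr scale0r add0r.
move=> a b t.
have [t0|t0] := ltP t 0.
  have [|s] := large b a (1 - t); first by lra.
  by rewrite subKr addrC => ->; exists (1 - s); rewrite subKr addrC.
have [t1|t1] := leP t 1; last exact: large.
have [|s _ ->] := fseg a b t; first by rewrite t0.
by exists s.
Qed.

(** * Fundamental theorem of affine geometry, with the origin fixed *)

Section FundamentalTheorem.
Variables (V W : lmodType R) (f : V -> W) (g : W -> V).
Hypotheses (fK : cancel f g) (gK : cancel g f).
Hypotheses (fseg : maps_segments f) (gseg : maps_segments g).
Hypothesis f0 : f 0 = 0.

Let g0 : g 0 = 0. Proof. by rewrite -f0 fK. Qed.

Let fline := maps_segments_lines (can_inj fK) fseg.
Let gline := maps_segments_lines (can_inj gK) gseg.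

Let frayE a t : exists s, f (t *: a) = s *: f a.
Proof.
have [s] := fline a 0 t; rewrite f0 !scaler0 !addr0 => ->.
by exists s.
Qed.

Let grayE a t : exists s, g (t *: a) = s *: g a.
Proof.
have [s] := gline a 0 t; rewrite g0 !scaler0 !addr0 => ->.
by exists s.
Qed.

(* The line through [a + b] and [b] is disjoint from the line through [0] and
   [a], hence so are their images; if [q] were not [1], these would meet. *)
Let parallel_coord a b p q : (forall r, b != r *: a) ->
  f (a + b) = p *: f a + q *: f b -> q = 1.
Proof.
move=> nba fab; apply: contrapT => /eqP q1.
have q1' : 1 - q != 0 by rewrite subr_eq0 eq_sym.
pose s := (1 - q)^-1.
have sE : s * q + (1 - s) = 0 by rewrite /s; field.
have [u] := gline (f (a + b)) (f b) s.
have -> : s *: f (a + b) + (1 - s) *: f b = (s * p) *: f a.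
  by rewrite fab scalerDr !scalerA -addrA -scalerDl sE scale0r addr0.
have [r ->] := grayE (f a) (s * p).
rewrite !fK scalerDr -addrA -scalerDl subrKC scale1r => /eqP.
by rewrite addrC -subr_eq -scalerBl eq_sym (negPf (nba _)).
Qed.

(** Since [a + b] is twice a midpoint, [f (a + b)] is some [p *: f a + q *: f b]; [parallel_coord],
    used in both directions, gives [q = 1] and [p = 1]. *)
Let additive_indep a b : (forall r, b != r *: a) -> (forall r, a != r *: b) ->
  f (a + b) = f a + f b.
Proof.
move=> nba nab.
have [r fm] := fline a b 2^-1.
have abE : a + b = 2 *: (2^-1 *: a + (1 - 2^-1) *: b).
  have -> : 1 - 2^-1 = 2^-1 :> R by field.
  by rewrite -scalerDr scalerA mulfV ?scale1r// pnatr_eq0.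
have [r' fab] := frayE (2^-1 *: a + (1 - 2^-1) *: b) 2.
rewrite -abE fm scalerDr !scalerA in fab.
have q1 := parallel_coord nba fab.
rewrite addrC [RHS]addrC in fab.
have p1 := parallel_coord nab fab.
by move: fab; rewrite q1 p1 !scale1r addrC => ->; rewrite addrC.
Qed.

Let additive_dir a c s : a != 0 -> (forall r, c != r *: a) ->
  f (s *: a + c) = f (s *: a) + f c.
Proof.
move=> a0 nca.
have [->|s0] := eqVneq s 0; first by rewrite scale0r f0 !add0r.
apply: additive_indep => r; first by rewrite scalerA.
apply/eqP => sac; have r0 : r != 0.
  by apply: contra_eq_neq sac => ->; rewrite scale0r scaler_eq0 negb_or s0.
have /eqP := nca (r^-1 * s); apply.
by rewrite -scalerA sac scalerA mulVf// scale1r.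
Qed.

(** Coordinate-free way to say that [V] is not a line. *)
Hypothesis indep : forall a : V, a != 0 -> exists c, forall r, c != r *: a.

(** An auxiliary [c] off the line of [a] reduces this to independent vectors: [f ((s + t) *: a + c)]
    is computed in two ways. *)
Let additive_ray a s t : f ((s + t) *: a) = f (s *: a) + f (t *: a).
Proof.
have [->|a0] := eqVneq a 0; first by rewrite !scaler0 f0 addr0.
have [c nca] := indep a0.
have nca' r : t *: a + c != r *: a.
  by rewrite addrC eq_sym -subr_eq -scalerBl eq_sym nca.
apply: (addIr (f c)).
rewrite -(additive_dir _ a0 nca) scalerDl -addrA (additive_dir _ a0 nca').
by rewrite (additive_dir _ a0 nca) addrA.
Qed.

(** The coefficient [h t] of [f (t *: a)] along [f a] is additive. As [f] maps the segment from [0]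
    to [a] into a segment, [h] is bounded on the unit interval, which rules out the wild solutions
    of Cauchy's equation. *)
Let homogeneous a t : f (t *: a) = t *: f a.
Proof.
have [->|a0] := eqVneq a 0; first by rewrite !scaler0 f0 scaler0.
have fa0 : f a != 0 by rewrite -f0 (can_eq fK).
have [h hE] := choice (frayE a).
have hD s u : h (s + u) = h s + h u.
  apply/eqP; rewrite -subr_eq0; have := additive_ray a s u.
  rewrite !hE -scalerDl => /eqP; rewrite -subr_eq0 -scalerBl scaler_eq0.
  by rewrite (negPf fa0) orbF.
have h1 : h 1 = 1.
  have := hE 1; rewrite scale1r => /eqP; rewrite -subr_eq0 -[X in X - _]scale1r.
  by rewrite -scalerBl scaler_eq0 (negPf fa0) orbF subr_eq0 => /eqP.
have h01 s : 0 <= s <= 1 -> 0 <= h s <= 1.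
  move=> s01; have [r r01] := fseg a 0 s01.
  rewrite f0 !scaler0 !addr0 hE => /eqP; rewrite -subr_eq0 -scalerBl.
  by rewrite scaler_eq0 (negPf fa0) orbF subr_eq0 => /eqP ->.
have h0 : h 0 = 0 by apply: (addrI (h 0)); rewrite -hD !addr0.
have hn s m : h (s *+ m) = h s *+ m.
  by elim: m => [|m IHm]; rewrite ?mulr0n// !mulrS hD IHm.
have hz (m : int) : h m%:~R = m%:~R.
  case: m => m; first by rewrite -pmulrn hn h1.
  rewrite NegzE mulrNz -pmulrn; apply: (addrI (h m.+1%:R)).
  by rewrite -hD subrr h0 hn h1 subrr.
(* [h s - s] is additive, [1]-periodic and bounded on [[0, 1]]. *)
have hbnd s : `|h s - s| <= 1.
  pose z : R := (Num.floor s)%:~R.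
  have zs : z <= s < z + 1.
    by have := floor_itv s; rewrite intrD.
  have /h01 : 0 <= s - z <= 1 by lra.
  have : h s = h (s - z) + z by rewrite -{2}[z]hz -hD subrK.
  by rewrite ler_norml; lra.
rewrite hE; congr (_ *: _); apply/eqP; rewrite -subr_eq0 -normr_le0 leNgt.
apply/negP => e0; set e := `|_| in e0.
(* The bound at the multiple [s *+ m] reads [m * e <= 1], which fails for [m > e^-1]. *)
have : (Num.truncn e^-1).+1%:R * e <= 1.
  rewrite mulr_natl /e -normrMn mulrnBl -hn; exact: hbnd.
rewrite -ler_pdivlMr// mul1r leNgt; apply/negP; rewrite negbK.
by rewrite truncnS_gt.
Qed.

Lemma segment_preserving_linear : forall s a b, f (s *: a + b) = s *: f a + f b.
Proof.
move=> s a b; have [->|a0] := eqVneq a 0; first by rewrite f0 !scaler0 !add0r.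
have [nba|] := pselect (forall r, b != r *: a).
  by rewrite additive_dir// homogeneous.
move=> /existsNP[r /negP]; rewrite negbK => /eqP ->.
by rewrite -scalerDl !homogeneous scalerDl.
Qed.

End FundamentalTheorem.
End SegmentPreserving.

(** * Linear and affine maps as matrices *)

Lemma linear_col_mx (R : comNzRingType) m n (f : 'cV[R]_n -> 'cV[R]_m) :
  (forall s a b, f (s *: a + b) = s *: f a + f b) ->
  exists A : 'M[R]_(m, n), forall v, f v = A *m v.
Proof.
move=> flin.
have fD a b : f (a + b) = f a + f b by rewrite -[a]scale1r flin !scale1r.
have f0 : f 0 = 0 by apply: (addrI (f 0)); rewrite -fD !addr0.
exists (\matrix_(i, j) f (delta_mx j 0) i 0) => v.
rewrite {1}[v]matrix_sum_delta (big_morph f fD f0).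
apply/colP => i; rewrite summxE mxE; apply: eq_bigr => j _.
by rewrite big_ord1 -[_ *: _]addr0 flin f0 addr0 !mxE mulrC.
Qed.

Lemma segment_preserving_affine (R : archiRealFieldType) n
    (f g : 'cV[R]_n -> 'cV[R]_n) : (2 <= n)%N -> cancel f g -> cancel g f ->
    maps_segments f -> maps_segments g ->
  exists A b, forall v, f v = A *m v + b.
Proof.
move=> n2 fK gK fseg gseg.
have e (t : R) (w : 'cV[R]_n) : w = t *: w + (1 - t) *: w.
  by rewrite -scalerDl subrKC scale1r.
have [|A fA] := @linear_col_mx R n n (fun v => f v - f 0).
  apply: (@segment_preserving_linear R _ _ _ (fun w => g (w + f 0))).
  - by move=> v; rewrite subrK fK.
  - by move=> w; rewrite gK addrK.
  - move=> a b t /(fseg a b)[s s01 ->]; exists s => //.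
    by rewrite {1}(e s (f 0)) !scalerBr opprD addrACA.
  - move=> a b t /(gseg (a + f 0) (b + f 0))[s s01 gE]; exists s => //.
    by rewrite -gE {1}(e t (f 0)) !scalerDr addrACA.
  - by rewrite subrr.
  (* A basis vector along a coordinate [j], distinct from some coordinate [i] where [a] does not
     vanish, is no multiple of [a]; this takes two coordinates. *)
  - move=> a a0; have [i ai] : exists i, a i 0 != 0.
      apply: contrapT => /forallNP a0'; move: a0; apply/negP; rewrite negbK.
      by apply/eqP/colP => i; rewrite mxE; apply/eqP/negPn/negP/a0'.
    have [j ji] : exists j : 'I_n, j != i.
      pose i0 := Ordinal (ltnW n2); pose i1 := Ordinal n2.
      by have [->|] := eqVneq i i0; [exists i1|exists i0; rewrite eq_sym].
    exists (delta_mx j 0) => r; apply/eqP => /matrixP ra.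
    have := ra i 0; rewrite !mxE eqxx andbT eq_sym (negPf ji) => /esym/eqP.
    rewrite mulf_eq0 (negPf ai) orbF => /eqP r0.
    have := ra j 0; rewrite !mxE !eqxx r0 mul0r => /eqP.
    by rewrite oner_eq0.
by exists A, (f 0) => v; rewrite -fA subrK.
Qed.

(** * Some convex functions *)

Section ConvexFunctions.
Variables (R : realType) (n : nat).
Let V : Type := 'cV[R]_n.
Implicit Types (f g : Cvxp R n) (x y z v : V) (K : set V) (c : R).

(** Covers both families of test functions: spikes for [K] a singleton, convex indicators of
    segments for [c = 0]. *)
Definition const_on K c : V -> \bar R :=
  fun v => if v \in K then c%:E else +oo%E.

Lemma const_on_Cvxp K c : closed K ->
    (forall x y t, 0 <= t <= 1 -> K x -> K y -> K (t *: x + (1 - t) *: y)) ->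
  0 <= c -> Cvxp R n (const_on K c).
Proof.
move=> Kclosed Kconvex c0; rewrite /const_on.
split => [v|x y t /andP[t0 t1]|v a].
- by case: ifP; rewrite ?lee_fin ?leey.
(* The endpoints are set apart because [0 * +oo = 0]; for [t] strictly between, an infinite value at
   [x] or [y] makes the right-hand side infinite. *)
- have [->|tn0] := eqVneq t 0.
    by rewrite subr0 mul0e add0e mul1e scale0r add0r scale1r.
  have [->|tn1] := eqVneq t 1.
    by rewrite subrr mul0e adde0 mul1e scale0r addr0 scale1r.
  have pt : 0 < t by rewrite lt_neqAle eq_sym tn0.
  have pt' : 0 < 1 - t by rewrite subr_gt0 lt_neqAle tn1.
  have [/set_mem Kx|_] := boolP (x \in K); last first.
    rewrite gt0_muley ?lte_fin// addye ?leey//.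
    by case: ifP => _; rewrite -?EFinM// gt0_muley ?lte_fin.
  have [/set_mem Ky|_] := boolP (y \in K); last first.
    by rewrite [X in (_ + X)%E]gt0_muley ?lte_fin// addey ?leey// -EFinM.
  rewrite mem_set; last by apply: Kconvex => //; rewrite t0.
  by rewrite -!EFinM -EFinD lee_fin -mulrDl subrKC mul1r.
- case: ifP => [_ ac|/negbT /negP vK _].
    exists setT; first exact: filterT.
    by move=> y _; case: ifP => // _; rewrite ltry.
  exists (~` K); last first.
    by move=> y Ky; rewrite memNset// ltry.
  apply: open_nbhs_nbhs; split; first exact: closed_openC.
  by move=> Kv; apply/vK/mem_set.
Qed.

Definition cone y k : V -> \bar R := fun v => (k * `|v - y|)%:E.

Lemma cone_Cvxp y k : 0 <= k -> Cvxp R n (cone y k).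
Proof.
move=> k0; split => [v|x x' t /andP[t0 t1]|].
- by rewrite lee_fin mulr_ge0.
- rewrite -!EFinM -EFinD lee_fin mulrCA [X in _ <= _ + X]mulrCA -mulrDr.
  apply: ler_wpM2l => //.
  have {1}-> : y = t *: y + (1 - t) *: y by rewrite -scalerDl subrKC scale1r.
  rewrite opprD addrACA -!scalerBr.
  by rewrite (le_trans (ler_normD _ _))// !normrZ !ger0_norm// subr_ge0.
- apply/lower_semicontinuousP => a.
  rewrite (_ : [set _ | _] =
      (fun v => k * `|v - y|) @^-1` [set r | a < r]); last first.
    by apply/seteqP; split=> v /=; rewrite lte_fin.
  apply: open_comp; last exact: open_gt.
  have kcont : continuous (fun v : 'cV[R]_n => k * `|v - y|).
    move=> v; apply: (@cvgM R V (nbhs v) _ (cst k) (fun v => `|v - y|)).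
      exact: cvg_cst.
    apply: cvg_norm; apply: cvgB; [exact: cvg_id|exact: cvg_cst].
  by move=> v _; exact: kcont.
Qed.

Lemma zero_Cvxp : Cvxp R n (cst 0%E).
Proof.
rewrite (_ : cst _ = cone 0 0); first exact: cone_Cvxp.
by apply/funext => v; rewrite /cone mul0r.
Qed.

(** Outside the class the value is the zero function; hence the side conditions [0 <= c] on the
    heights of spikes. *)
Definition to_Cvxp (h : V -> \bar R) : Cvxp R n :=
  insubd (Sub (cst 0%E) (mem_set zero_Cvxp) : Cvxp R n) h.

Lemma to_CvxpK h : Cvxp R n h -> \val (to_Cvxp h) = h.
Proof. by move=> hC; rewrite insubdK//; exact: mem_set. Qed.

Lemma Cvxp_ge0 f x : (0 <= \val f x)%E.
Proof. by case: f => f /= /set_mem[]. Qed.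

Lemma Cvxp_convex f : econvex (\val f).
Proof. by case: f => f /= /set_mem[]. Qed.

(** The apex [y] is determined by [z = s *: x + (1 - s) *: y] and differs from [x] because [z] does;
    the slope is chosen to give height [a] at [x]. *)
Lemma cone_values x z s a : x != z -> 0 < s < 1 -> 0 <= a ->
  exists y f, [/\ z = s *: x + (1 - s) *: y, \val f y = 0%E,
    \val f x = a%:E & \val f z = (s * a)%:E].
Proof.
move=> xz /andP[s0 s1] a0.
have s1' : 1 - s != 0 by rewrite subr_eq0 gt_eqF.
pose y := (1 - s)^-1 *: (z - s *: x).
have zE : z = s *: x + (1 - s) *: y by rewrite scalerA mulfV// scale1r subrKC.
have zy : z - y = s *: (x - y).
  by rewrite {1}zE scalerBl scale1r scalerBr addrA addrAC addrK.
have xy : `|x - y| != 0.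
  rewrite normr_eq0 subr_eq0; apply: contra_neq xz => xy.
  by rewrite zE -xy -scalerDl subrKC scale1r.
have k0 : 0 <= a / `|x - y| by rewrite divr_ge0.
exists y, (to_Cvxp (cone y (a / `|x - y|))).
rewrite to_CvxpK; last exact: cone_Cvxp.
split=> //; rewrite /cone.
- by rewrite subrr normr0 mulr0.
- by rewrite divfK.
- by rewrite zy normrZ gtr0_norm// mulrCA divfK.
Qed.

Lemma segment_closed x y :
  closed [set t *: x + (1 - t) *: y | t in `[0, 1 : R]].
Proof.
apply: compact_closed; first exact: norm_hausdorff.
apply: continuous_compact; last exact: segment_compact.
apply: continuous_subspaceT => t.
apply: cvgD; first by apply: cvgZl; exact: cvg_id.
by apply: cvgZl; apply: cvgB; [exact: cvg_cst|exact: cvg_id].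
Qed.

Definition spike x c : Cvxp R n := to_Cvxp (const_on [set x] c).

Lemma spikeE x c : 0 <= c ->
  \val (spike x c) = fun v => if v == x then c%:E else +oo%E.
Proof.
move=> c0; rewrite to_CvxpK; last first.
  apply: const_on_Cvxp => //.
    by apply/accessible_closed_set1/hausdorff_accessible/norm_hausdorff.
  by move=> _ _ t _ -> ->; rewrite -scalerDl subrKC scale1r.
apply/funext => v; rewrite /const_on.
by have -> : (v \in [set x]) = (v == x) by apply/idP/eqP; rewrite inE.
Qed.

Lemma spike_inj x y c d : 0 <= c -> 0 <= d ->
  spike x c = spike y d -> x = y /\ c = d.
Proof.
move=> c0 d0 /(congr1 (fun f => \val f x)); rewrite !spikeE// eqxx.
by case: eqP => // -> [->].
Qed.

End ConvexFunctions.

(** * Action on spikes *)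

Section SpikeAction.
Variables (R : realType) (n : nat).
Local Notation V := 'cV[R]_n.
Implicit Types (f g : Cvxp R n) (x y z v : V) (T S : Cvxp R n -> Cvxp R n).

(** The constant is a parameter so that a map and its inverse can share it. *)
Definition quasi_monotone (C : R) T := forall f g,
  (forall x, \val f x <= \val g x)%E ->
  forall x, (\val (T f) x <= C%:E * \val (T g) x)%E.

Definition spike_action T (phi : V -> V) (alpha : V -> R -> R) :=
  forall x c, 0 <= c ->
    0 <= alpha x c /\ T (spike x c) = spike (phi x) (alpha x c).

Lemma spike_ge f x c : 0 <= c ->
  (\val f x <= c%:E)%E -> forall v, (\val f v <= \val (spike x c) v)%E.
Proof.
by move=> c0 fx v; rewrite spikeE//; case: eqP => [->|]//; rewrite leey.
Qed.

(** * Images of spikes are spikes *)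

Section Image.
Variables (C : R) (T S : Cvxp R n -> Cvxp R n).
Hypotheses (TK : cancel T S) (SK : cancel S T).
Hypotheses (Tmono : quasi_monotone C T) (Smono : quasi_monotone C S).
Hypothesis n0 : (0 < n)%N.

Let another x : exists y, y != x.
Proof.
exists (x + delta_mx (Ordinal n0) 0); rewrite -subr_eq0 addrC addKr.
apply/eqP => /matrixP/(_ (Ordinal n0) 0); rewrite !mxE !eqxx => /eqP.
by rewrite oner_eq0.
Qed.

(** If the image were infinite everywhere it would dominate [T (spike y 0)] for some [y != x];
    applying [S], [spike y 0] would be finite at [x]. *)
Let T_spike_proper x c : 0 <= c -> exists y, (\val (T (spike x c)) y < +oo)%E.
Proof.
move=> c0; apply: contrapT => /forallNP noy.
have [y yx] := another x.
have := Smono (f := T (spike y 0)) (g := T (spike x c)) _ x.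
rewrite !TK !spikeE// eqxx eq_sym (negPf yx) -EFinM.
have /[swap]/[apply] :
    forall v, (\val (T (spike y 0)) v <= \val (T (spike x c)) v)%E.
  move=> v; have /negP := noy v; rewrite -leNgt leye_eq => /eqP ->.
  by rewrite leey.
by rewrite leye_eq.
Qed.

(* The functions above a spike, up to a factor, form a chain, whereas spikes
   at two distinct points of the domain of [T (spike x c)] would be
   incomparable. *)
Let T_spike_domain x c y1 y2 : 0 <= c -> (\val (T (spike x c)) y1 < +oo)%E ->
  (\val (T (spike x c)) y2 < +oo)%E -> y1 = y2.
Proof.
move=> c0; set F := T _.
have dom y : (\val F y < +oo)%E -> exists2 d, 0 <= d &
    forall v, v != x -> \val (S (spike y d)) v = +oo%E.
  move=> Fy; have dE : (fine (\val F y))%:E = \val F y.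
    by rewrite fineK// ge0_fin_numE// Cvxp_ge0.
  have d0 : 0 <= fine (\val F y) by rewrite fine_ge0// Cvxp_ge0.
  exists (fine (\val F y)) => // v vx.
  have := Smono (spike_ge (f := F) d0 _) v; rewrite dE => /(_ _ (lexx _)).
  rewrite TK spikeE// (negPf vx) leye_eq.
  have := Cvxp_ge0 (S (spike y (fine (\val F y)))) v.
  by case: (\val _ v) => // r; rewrite -EFinM.
(* A function infinite off [x] is compared with another by their values at [x] alone; applying [T],
   one spike bounds the other up to a factor, so their points agree. *)
have comparable y d y' d' : 0 <= d -> 0 <= d' ->
    (forall v, v != x -> \val (S (spike y' d')) v = +oo%E) ->
    (\val (S (spike y d)) x <= \val (S (spike y' d')) x)%E -> y' = y.
  move=> d0 d'0 off le_x.
  have := Tmono (f := S (spike y d)) (g := S (spike y' d')) _ y'.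
  rewrite !SK !spikeE// eqxx; case: eqP => // _ /(_ _); rewrite -EFinM leye_eq.
  move=> h; suff: false by [].
  apply: h => v; have [->//|vx] := eqVneq v x.
  by rewrite off// leey.
move=> /dom[d1 d10 off1] /dom[d2 d20 off2].
have [le12|/ltW le21] :=
  leP (\val (S (spike y1 d1)) x) (\val (S (spike y2 d2)) x).
  exact/esym/(comparable y1 d1 y2 d2).
exact: (comparable y2 d2 y1 d1).
Qed.

Lemma T_spike x c : 0 <= c ->
  exists y d, 0 <= d /\ T (spike x c) = spike y d.
Proof.
move=> c0; have [y Fy] := T_spike_proper x c0.
have d0 : 0 <= fine (\val (T (spike x c)) y) by rewrite fine_ge0// Cvxp_ge0.
exists y, (fine (\val (T (spike x c)) y)); split=> //.
apply/val_inj/funext => v; rewrite (spikeE _ d0).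
have [->|vy] := eqVneq v y; first by rewrite fineK// ge0_fin_numE// Cvxp_ge0.
apply/eqP; rewrite -leye_eq leNgt; apply/negP => /(T_spike_domain c0 Fy) yv.
by rewrite yv eqxx in vy.
Qed.

(** Spikes at one point are ordered by height, so their images are ordered up to a factor, which is
    impossible at distinct points. *)
Let T_spike_point x c c' y y' d d' : 0 <= c -> c <= c' -> 0 <= d -> 0 <= d' ->
  T (spike x c) = spike y d -> T (spike x c') = spike y' d' -> y' = y.
Proof.
move=> c0 cc' d0 d'0 Ty Ty'; have c'0 := le_trans c0 cc'.
have := Tmono (f := spike x c) (g := spike x c') _ y'.
rewrite Ty Ty' !spikeE// eqxx; case: eqP => // _.
rewrite -EFinM leye_eq => h; suff: false by [].
by apply: h => v; case: eqP; rewrite ?lee_fin.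
Qed.

Lemma spike_actionP : exists phi alpha, spike_action T phi alpha.
Proof.
(* The point is read off at height 0, which lies below all other heights; [T_spike_point] carries it
   to them. Negative heights get the dummy value 0. *)
have /choice[phi /choice[alpha0 phiE]] : forall x, exists y, exists d,
  0 <= d /\ T (spike x 0) = spike y d by move=> x; exact: T_spike.
have /choice[alpha alphaE] : forall p : V * R, exists d, 0 <= p.2 ->
    0 <= d /\ T (spike p.1 p.2) = spike (phi p.1) d.
  case=> x c /=; have [c0|] := leP 0 c; last by exists 0.
  have [y [d [d0 Ty]]] := T_spike x c0; exists d => _; split=> //.
  have [a0 Ta] := phiE x.
  by rewrite -(T_spike_point (lexx 0) c0 a0 d0 Ta Ty).
by exists phi, (fun x c => alpha (x, c)) => x c c0; have := alphaE (x, c) c0.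
Qed.

End Image.

Lemma spike_actionK T S phi alpha psi beta : cancel T S ->
  spike_action T phi alpha -> spike_action S psi beta ->
  forall x c, 0 <= c -> psi (phi x) = x /\ beta (phi x) (alpha x c) = c.
Proof.
move=> TK Tact Sact x c c0; have [a0 Tx] := Tact x c c0.
have [b0] := Sact (phi x) _ a0; rewrite -Tx TK => /spike_inj.
by case=> // <- <-.
Qed.

(** * Comparison of functions with spikes *)

Section Comparison.
Variables (C : R) (T S : Cvxp R n -> Cvxp R n).
Variables (phi psi : V -> V) (alpha beta : V -> R -> R).
Hypotheses (TK : cancel T S) (SK : cancel S T).
Hypotheses (Tmono : quasi_monotone C T).
Hypotheses (Tact : spike_action T phi alpha) (Sact : spike_action S psi beta).

Lemma spike_upper f x c : 0 <= c -> (\val f x <= c%:E)%E ->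
  (\val (T f) (phi x) <= (C * alpha x c)%:E)%E.
Proof.
move=> c0 fx; have [a0 Tx] := Tact x c0.
by have := Tmono (spike_ge c0 fx) (phi x); rewrite Tx spikeE// eqxx EFinM.
Qed.

Lemma spike_heights_mono x c c' : 0 <= c -> c <= c' ->
  alpha x c <= C * alpha x c'.
Proof.
move=> c0 cc'; have [a0 Tx] := Tact x c0.
have := @spike_upper (spike x c) x c' (le_trans c0 cc').
by rewrite Tx !spikeE// !eqxx !lee_fin; apply.
Qed.

(** Some height at [x], namely [beta (phi x) 0], is sent to 0, and monotonicity up to a factor
    pushes the image of the lower height 0 down to 0. *)
Lemma spike_heights0 x : alpha x 0 = 0.
Proof.
have [b0 _] := Sact (phi x) (lexx 0).
have [a0 _] := Tact x (lexx 0).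
have [_ psiK] := spike_actionK SK Sact Tact (phi x) (lexx 0).
have [phiK _] := spike_actionK TK Tact Sact x (lexx 0).
rewrite phiK in psiK.
have := spike_heights_mono x (lexx 0) b0.
by rewrite psiK mulr0 => a0'; apply/eqP; rewrite eq_le a0' a0.
Qed.

(** At height 0 the factor [C] is harmless, so zeros are carried over exactly; this gives exact
    geometry from approximate order. *)
Lemma zeros_image f x : \val f x = 0%E -> \val (T f) (phi x) = 0%E.
Proof.
move=> fx; have := @spike_upper f x 0 (lexx 0); rewrite fx lexx => /(_ isT).
by rewrite spike_heights0 mulr0 => Tf; apply/eqP; rewrite eq_le Tf Cvxp_ge0.
Qed.

End Comparison.
End SpikeAction.

(** * Linear growth of the heights *)

Section Stability.
Variables (R : realType) (n : nat).
Local Notation V := 'cV[R]_n.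
Variables (C : R) (T S : Cvxp R n -> Cvxp R n).
Variables (phi psi : V -> V) (alpha beta : V -> R -> R).
Hypotheses (C1 : 1 < C) (TK : cancel T S) (SK : cancel S T).
Hypotheses (Tmono : quasi_monotone C T) (Smono : quasi_monotone C S).
Hypotheses (Tact : spike_action T phi alpha) (Sact : spike_action S psi beta).
Implicit Types (f g : Cvxp R n) (x y z v : V).

Let C0 : 0 < C. Proof. exact: lt_trans C1. Qed.

Let phiK x : psi (phi x) = x.
Proof. by have [] := spike_actionK TK Tact Sact x (lexx 0). Qed.

Let psiK x : phi (psi x) = x.
Proof. by have [] := spike_actionK SK Sact Tact x (lexx 0). Qed.

Let betaK x c : 0 <= c -> alpha x (beta (phi x) c) = c.
Proof.
by move=> c0; have [_] := spike_actionK SK Sact Tact (phi x) c0; rewrite phiK.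
Qed.

(** The indicator [g] of the segment from [phi a] to [phi b] pulls back to a function vanishing at
    [a] and [b], hence by convexity between them; [T] sends these zeros back to zeros of [g]. *)
Lemma spike_map_segments : maps_segments phi.
Proof.
move=> a b t t01; have [t0 t1] := andP t01.
pose K := [set s *: phi a + (1 - s) *: phi b | s in `[0, 1 : R]].
have Kclosed : closed K by exact: segment_closed.
have Kconvex v w r : 0 <= r <= 1 -> K v -> K w -> K (r *: v + (1 - r) *: w).
  move=> /andP[r0 r1] [p /=]; rewrite in_itv/= => /andP[p0 p1] <-.
  move=> [q /=]; rewrite in_itv/= => /andP[q0 q1] <-.
  exists (r * p + (1 - r) * q).
    by rewrite /= in_itv/=; apply/andP; split; nra.
  rewrite !scalerDr !scalerA addrACA -!scalerDl; congr (_ + _ *: _).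
  by ring.
have KE := to_CvxpK (const_on_Cvxp Kclosed Kconvex (lexx 0)).
set g := to_Cvxp (const_on K 0) in KE.
have gphi v : K (phi v) -> \val (S g) v = 0%E.
  move=> Kv; rewrite -(phiK v); apply: (zeros_image SK TK Smono Sact Tact).
  by rewrite KE /const_on mem_set.
have Sga : \val (S g) a = 0%E.
  apply: gphi; exists 1; first by rewrite /= in_itv/= ler01 lexx.
  by rewrite subrr scale1r scale0r addr0.
have Sgb : \val (S g) b = 0%E.
  apply: gphi; exists 0; first by rewrite /= in_itv/= ler01 lexx.
  by rewrite subr0 scale1r scale0r add0r.
have Sgt : \val (S g) (t *: a + (1 - t) *: b) = 0%E.
  apply/eqP; rewrite eq_le Cvxp_ge0 andbT.
  by have := Cvxp_convex (S g) a b t01; rewrite Sga Sgb !mule0 adde0.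
have := zeros_image TK SK Tmono Tact Sact Sgt; rewrite SK KE /const_on.
case: ifP => // /set_mem[s /=]; rewrite in_itv/= => s01 <- _.
by exists s.
Qed.

Hypothesis phi_affine : forall x y t,
  phi (t *: x + (1 - t) *: y) = t *: phi x + (1 - t) *: phi y.

(** [T f] vanishes at the image of the apex and is at most [C * alpha x a] at [phi x]; [phi z]
    divides these two points in the ratio of [z], so convexity applies. *)
Lemma cone_image x z s a : x != z -> 0 < s < 1 -> 0 <= a ->
  exists f, \val f z = (s * a)%:E /\
    (\val (T f) (phi z) <= (s * (C * alpha x a))%:E)%E.
Proof.
move=> xz s01 a0; have [s0 s1] := andP s01.
have [y [f [zE fy fx fz]]] := cone_values xz s01 a0.
exists f; split=> //; rewrite {1}zE phi_affine.
have s01' : 0 <= s <= 1 by rewrite !ltW.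
apply: le_trans (Cvxp_convex (T f) (phi x) (phi y) s01') _.
rewrite (zeros_image TK SK Tmono Tact Sact fy) mule0 adde0.
rewrite EFinM lee_pmul2l ?lte_fin//.
by apply: (spike_upper Tmono Tact); rewrite ?fx.
Qed.

(** With [e] the value of [T f] at [phi z], comparing [T f] with the spike of height [e] and
    applying [S] gives [s * a <= C * beta (phi z) e]; then [alpha z] is applied to the heights. *)
Lemma heights_contract x z s a : x != z -> 0 < s < 1 -> 0 <= a ->
  alpha z (s * a / C) <= C * (s * (C * alpha x a)).
Proof.
move=> xz s01 a0; have [f [fz Tfz]] := cone_image xz s01 a0.
have [s0 _] := andP s01.
have Tf0 := Cvxp_ge0 (T f) (phi z).
have eE : (fine (\val (T f) (phi z)))%:E = \val (T f) (phi z).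
  by rewrite fineK// ge0_fin_numE// (le_lt_trans Tfz)// ltry.
set e := fine _ in eE.
have e0 : 0 <= e by rewrite -lee_fin eE.
have := @spike_upper _ _ C S psi beta Smono Sact (T f) (phi z) e e0.
rewrite -eE lexx TK phiK fz lee_fin => /(_ isT) le1.
have le2 : s * a / C <= beta (phi z) e by rewrite ler_pdivrMr// [leRHS]mulrC.
have sa0 : 0 <= s * a / C by rewrite !mulr_ge0 ?invr_ge0// ltW.
apply: le_trans (spike_heights_mono Tmono Tact z sa0 le2) _.
by rewrite betaK// ler_pM2l// -lee_fin eE.
Qed.

End Stability.

(** * A linear bound on the heights, uniform in the point *)

Section StabilityBound.
Variables (R : realType) (n : nat).
Local Notation V := 'cV[R]_n.
Variables (C : R) (T S : Cvxp R n -> Cvxp R n).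
Variables (phi psi : V -> V) (alpha beta : V -> R -> R).
Hypotheses (C1 : 1 < C) (TK : cancel T S) (SK : cancel S T).
Hypotheses (Tmono : quasi_monotone C T) (Smono : quasi_monotone C S).
Hypotheses (Tact : spike_action T phi alpha) (Sact : spike_action S psi beta).
Hypothesis phi_affine : forall x y t,
  phi (t *: x + (1 - t) *: y) = t *: phi x + (1 - t) *: phi y.
Hypothesis psi_affine : forall x y t,
  psi (t *: x + (1 - t) *: y) = t *: psi x + (1 - t) *: psi y.

Let C0 : 0 < C. Proof. exact: lt_trans C1. Qed.

(** [cone_image] for the inverse, with a cone of height [alpha x a] at [phi x], followed by [T]. *)
Lemma heights_expand (x z : V) s a : x != z -> 0 < s < 1 -> 0 <= a ->
  s * alpha x a <= C * alpha z (s * (C * a)).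
Proof.
move=> xz s01 a0; have [s0 _] := andP s01.
have [alpha0 _] := Tact x a0.
have [psiphi_x ba] := spike_actionK TK Tact Sact x a0.
have [psiphi_z _] := spike_actionK TK Tact Sact z a0.
have pxz : phi x != phi z.
  by apply: contra_neq xz => e; rewrite -psiphi_x e psiphi_z.
have [g [gz Sgz]] := cone_image SK TK Smono Sact Tact psi_affine pxz s01 alpha0.
rewrite ba psiphi_z in Sgz.
have sa0 : 0 <= s * (C * a) by rewrite !mulr_ge0// ltW.
by have := spike_upper Tmono Tact sa0 Sgz; rewrite SK gz lee_fin.
Qed.

Lemma heights_bound (x : V) : exists2 k, 0 <= k &
  forall z b, x != z -> 0 <= b -> alpha z b <= k * b.
Proof.
have [a1 _] := Tact x ler01.
have [a2 _] := Tact x (ler0n R 2).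
(* The first term serves [C * b > 1]: [heights_expand] from [z] to [x] with [s = (C * b)^-1] lands
   at height 1. The second serves [C * b <= 1]: [heights_contract] from height 2 at [x] with
   [s = C * b / 2], where 2 keeps [s] below 1. *)
exists (C ^+ 2 * alpha x 1 + C ^+ 3 * alpha x 2).
  by rewrite addr_ge0// mulr_ge0// exprn_ge0// ltW.
move=> z b xz; rewrite le_eqVlt => /predU1P[<-|b0].
  by rewrite (spike_heights0 TK SK Tmono Tact Sact) mulr0.
have [C_ge0 b_ge0] := (ltW C0, ltW b0).
rewrite mulrDl; have [Cb|Cb] := ltP 1 (C * b).
  apply: ler_wpDr; first by rewrite !mulr_ge0 ?exprn_ge0.
  have s01 : 0 < (C * b)^-1 < 1.
    by rewrite invr_gt0 mulr_gt0//= invf_lt1 ?mulr_gt0.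
  have zx : z != x by rewrite eq_sym.
  have := heights_expand zx s01 (ltW b0).
  rewrite mulVf ?gt_eqF ?mulr_gt0// mulrC ler_pdivrMr ?mulr_gt0//.
  move=> /le_trans; apply.
  by rewrite expr2 le_eqVlt; apply/orP; left; apply/eqP; ring.
apply: ler_wpDl; first by rewrite !mulr_ge0 ?exprn_ge0.
have s01 : 0 < C * b / 2 < 1.
  by rewrite divr_gt0 ?mulr_gt0//= ltr_pdivrMr// mul1r (le_lt_trans Cb)// ltr1n.
have := heights_contract C1 TK SK Tmono Smono Tact Sact phi_affine
  xz s01 (ler0n R 2).
rewrite divfK// [C * b]mulrC mulfK ?gt_eqF// => /le_trans; apply.
have : 0 <= C ^+ 3 * alpha x 2 * b by rewrite !mulr_ge0 ?exprn_ge0.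
by lra.
Qed.

Lemma stability_upper : (0 < n)%N -> exists2 k, 0 < k &
  forall (f : Cvxp R n) x, (\val (T f) (phi x) <= k%:E * \val f x)%E.
Proof.
move=> n0; pose p : V := delta_mx (Ordinal n0) 0.
have p0 : p != 0.
  by apply/eqP => /matrixP/(_ (Ordinal n0) 0)/eqP; rewrite !mxE !eqxx oner_eq0.
have [k0 k0_ge0 k0P] := heights_bound 0.
have [k1 k1_ge0 k1P] := heights_bound p.
(* The bound based at 0 misses only the point 0, which the one based at [p] covers. The summand 1
   makes [k] positive, so that [k * +oo = +oo]. *)
pose k := C * (k0 + k1 + 1).
have k_gt0 : 0 < k by rewrite mulr_gt0// ltr_wpDl// addr_ge0.
exists k => // f x.
have := Cvxp_ge0 f x; case fx: (\val f x) => [c||//]; last first.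
  by move=> _; rewrite gt0_muley ?lte_fin// leey.
rewrite lee_fin => c0.
have := @spike_upper _ _ C T phi alpha Tmono Tact f x c c0; rewrite fx lexx.
move=> /(_ isT)/le_trans; apply; rewrite -EFinM lee_fin /k -mulrA ler_pM2l//.
have [x0|x0] := eqVneq 0 x.
  have := k1P x c; rewrite -x0 => /(_ p0 c0); nra.
have := k0P x c x0 c0; nra.
Qed.

End StabilityBound.

(* [S] is the inverse of the bijection [T]. *)
Theorem theorem1p9 (R : realType) (n : nat) (hn : (2 <= n)%N)
    (T S : Cvxp R n -> Cvxp R n) (TK : cancel T S) (SK : cancel S T)
    (hT : almost_order_preserving T) (hS : almost_order_preserving S) :
  exists (B : 'M[R]_n) (b0 : 'cV[R]_n) (c C : R),
    [/\ B \in unitmx, 0 < c, 0 < C &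
      forall (f : Cvxp R n) (x : 'cV[R]_n),
        (c%:E * \val f (B *m x + b0)%R <= \val (T f) x
           <= C%:E * \val f (B *m x + b0)%R)%E].
Proof.
have n0 : (0 < n)%N := ltnW hn.
case: hT => C1 C1_gt1 T_aop; case: hS => C2 C2_gt1 S_aop.
pose C := Num.max C1 C2.
have C_gt1 : 1 < C by rewrite lt_max C1_gt1.
have mono U D : D <= C -> (forall f g : Cvxp R n,
    ((forall x, \val f x <= \val g x) ->
       forall x, \val (U f) x <= D%:E * \val (U g) x)%E) -> quasi_monotone C U.
  move=> DC Umono f g fg x; apply: le_trans (Umono f g fg x) _.
  by rewrite lee_wpmul2r ?Cvxp_ge0// lee_fin.
have Tmono : quasi_monotone C T.
  by apply: (mono T C1) => [|f g]; [rewrite le_max lexx|case: (T_aop f g)].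
have Smono : quasi_monotone C S.
  by apply: (mono S C2) => [|f g]; [rewrite le_max lexx orbT|case: (S_aop f g)].
have [phi [alpha Tact]] := spike_actionP TK SK Tmono Smono n0.
have [psi [beta Sact]] := spike_actionP SK TK Smono Tmono n0.
have phiK x : psi (phi x) = x.
  by have [] := spike_actionK TK Tact Sact x (lexx 0).
have psiK x : phi (psi x) = x.
  by have [] := spike_actionK SK Sact Tact x (lexx 0).
have phi_seg := spike_map_segments TK SK Tmono Smono Tact Sact.
have psi_seg := spike_map_segments SK TK Smono Tmono Sact Tact.
have [A [a0 phiE]] := segment_preserving_affine hn phiK psiK phi_seg psi_seg.
have [B [b0 psiE]] := segment_preserving_affine hn psiK phiK psi_seg phi_seg.
have affine (h : 'cV[R]_n -> 'cV[R]_n) (M : 'M[R]_n) m :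
    (forall v, h v = M *m v + m) ->
    forall x y t, h (t *: x + (1 - t) *: y) = t *: h x + (1 - t) *: h y.
  move=> hE x y t; rewrite !hE mulmxDr -!scalemxAr !scalerDr addrACA.
  by rewrite -(scalerDl m) subrKC scale1r.
have [k k0 Tk] := stability_upper C_gt1 TK SK Tmono Smono Tact Sact
  (affine _ _ _ phiE) (affine _ _ _ psiE) n0.
have [l l0 Sl] := stability_upper C_gt1 SK TK Smono Tmono Sact Tact
  (affine _ _ _ psiE) (affine _ _ _ phiE) n0.
(* The change of variable is [psi]: the bound for [T] at [psi x] gives the upper estimate, the bound
   for [S] applied to [T f] the lower one. *)
exists B, b0, l^-1, k; split; rewrite ?invr_gt0//.
  (* From [phi (psi v) = v], whose constant part vanishes by taking [v = 0]. *)
  have AB (v : 'cV[R]_n) : A *m (B *m v) = v.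
    have AB0 w : A *m (B *m w) + (A *m b0 + a0) = w.
      by rewrite addrA -mulmxDr -psiE -phiE psiK.
    have := AB0 0; rewrite !mulmx0 add0r => c0.
    by have := AB0 v; rewrite c0 addr0.
  suff /mulmx1_unit[] : A *m B = 1%:M by [].
  apply/matrixP => i j.
  have /matrixP/(_ i 0) := AB (delta_mx j 0).
  by rewrite mulmxA -colE !mxE eqxx andbT.
move=> f x; rewrite -psiE; apply/andP; split.
  by rewrite lee_pdivrMl//; have := Sl (T f) x; rewrite TK.
by have := Tk f (psi x); rewrite psiK.
Qed.
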